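(* For every positive integer $q$ there exists a constant $C_q$ depending on $q$ only such that the following holds. Let $N\ge 1$ be an integer, let $\varphi_1,\ldots,\varphi_N$ be linearly independent reals (over $\mathbb{Q}$), let $c_1,\ldots,c_N$ be complex numbers, let $J$ be a bounded interval of the real line of positive length $|J|$, and put $P(t)=\sum_{n=1}^N c_n e^{it\varphi_n}$ and $\tilde\varphi_N=\sup_{n\le N}|\varphi_n|$. Then for any interval $L$ of the real line, with length $|L|$, $$\Big(\frac{1}{|J|}\int_J \Big(\sup_{t\in L}|P(\theta+t)|\Big)^{2q}\,d\theta\Big)^{1/2q}\le C_q\,\mathcal{B}\,\max\big\{1,|L|\tilde\varphi_N\big\}^{1/2q}\bigg\{\Big[\sum_{n=1}^N|c_n|^2\Big]^{1/2}+\min\Big(|L|,\frac{1}{\tilde\varphi_N}\Big)\Big[\sum_{n=1}^N|c_n|^2\varphi_n^2\Big]^{1/2}\bigg\},$$ where $$\mathcal{B}=\Big[q!\Big(1+\frac{2\pi}{|J|\,\xi_\varphi(N,q)}\Big)\Big]^{1/2q}.$$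
   Context: Let $E_q$ be the set of $N$-tuples $\underline{k}=(k_1,\ldots,k_N)$ of nonnegative integers with $k_1+\cdots+k_N=q$. The coefficient of linear spacing of order $q$ of $\varphi_1,\ldots,\varphi_N$ is $$\xi_\varphi(N,q)=\inf_{\underline{h},\underline{k}\in E_q,\ \underline{h}\ne\underline{k}}\big|(h_1-k_1)\varphi_1+\cdots+(h_N-k_N)\varphi_N\big|,$$ which is positive by linear independence (with the usual convention that an infimum over the empty set is $+\infty$). *)

(* Defs.v *)
From mathcomp Require Import all_boot all_order all_algebra.
From mathcomp Require Import all_classical all_reals all_analysis.
From mathcomp Require Import complex.

Set Implicit Arguments.
Unset Strict Implicit.
Unset Printing Implicit Defensive.

Import Order.TTheory GRing.Theory Num.Theory.
Import numFieldNormedType.Exports.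

Local Open Scope classical_set_scope.
Local Open Scope ring_scope.

(* [free] from vector.v is not available here: R is not a finite-dimensional
   space over rat. *)
Definition rat_lin_indep (R : realType) (N : nat) (phi : 'I_N -> R) : Prop :=
  forall a : 'I_N -> rat,
    \sum_(n < N) ratr (a n) * phi n = 0 -> forall n, a n = 0.

Definition simplex_pts (N q : nat) : set {ffun 'I_N -> nat} :=
  [set k | (\sum_(n < N) k n = q)%N].

(* The infimum is taken in \bar R, so that it is +oo over the empty set
   (which happens for N = 1). *)
Definition lin_spacing (R : realType) (N : nat) (phi : 'I_N -> R) (q : nat)
    : \bar R :=
  ereal_inf [set x | exists h k : {ffun 'I_N -> nat},
    [/\ simplex_pts q h, simplex_pts q k, h != k &
        x = (`|\sum_(n < N) ((h n)%:R - (k n)%:R) * phi n|)%:E]].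

Definition expi (R : realType) (x : R) : R[i] := (cos x +i* sin x)%C.

Definition exp_sum (R : realType) (N : nat) (c : 'I_N -> R[i])
    (phi : 'I_N -> R) (t : R) : R[i] :=
  \sum_(n < N) c n * expi (t * phi n).

(* Complex modulus with values in R; the norm of R[i] is R[i]-valued. *)
Definition cmod (R : realType) (z : R[i]) : R := complex.Re `|z|.

(* Starting the maximum at 0 is harmless, as all terms are nonnegative. *)
Definition max_abs (R : realType) (N : nat) (phi : 'I_N -> R) : R :=
  \big[Num.max/0]_(n < N) `|phi n|.

Definition itv_length (R : realType) (I : set R) : \bar R := lebesgue_measure I.

Definition spacing_factor (R : realType) (N : nat) (phi : 'I_N -> R) (q : nat)
    (J : set R) : \bar R :=
  (((q`!)%:R%:E * (1 + (2 * pi)%:E / (itv_length J * lin_spacing phi q)))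
     `^ (2 * q)%:R^-1)%E.

(* Main.v *)
Require Import Defs.
From mathcomp Require Import all_boot all_order all_algebra.
From mathcomp Require Import all_classical all_reals all_analysis.
From mathcomp Require Import measurable_realfun complex.
From mathcomp Require Import ring lra.

Set Implicit Arguments.
Unset Strict Implicit.
Unset Printing Implicit Defensive.

Import Order.TTheory GRing.Theory Num.Theory.
Import numFieldNormedType.Exports.

Local Open Scope classical_set_scope.
Local Open Scope ring_scope.

(* The [q]-th power of [P] is an exponential sum over functions
   [f : 'I_q -> 'I_N], with coefficients [\prod_i c (f i)] and frequencies
   [\sum_i phi (f i)].  Two such frequencies at distance less than
   [lin_spacing phi q] come from functions with the same fiber sizes, so a
   frequency has at most [q ^ q] close ones.  Integrating [|P ^ q| ^ 2] against
   a parabola of width about [|J| + 1 / lin_spacing phi q], whose Fourier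
   transform decays quadratically, Schur's test bounds the [2 q]-th moment of
   [P] on [J] (this replaces Hilbert's inequality, at the cost of a constant).

   For the supremum, [L] is cut into at most [2 max(1, |L| max|phi|)] pieces of
   length [d = min(|L|, 1 / max|phi|)].  On each of them the fundamental theorem
   of calculus bounds [|P| ^ (2 q)] by its value at the left end plus the
   integral of its derivative, which Young's inequality dominates by
   [|P| ^ (2 q) + d ^ (2 q) |P'| ^ (2 q)] up to the factor [2 q / d].  After
   Tonelli's theorem it remains to apply the moment bound to [P] and [P']. *)

Section complex_modulus.
Context {R : realType}.
Implicit Types z w : R[i].

Lemma cmodE z : (cmod z)%:C%C = `|z|.
Proof. by rewrite /cmod normc_def. Qed.

Lemma cmod_ge0 z : 0 <= cmod z.
Proof. by rewrite /cmod normc_def sqrtr_ge0. Qed.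

Lemma cmod_sqr z : cmod z ^+ 2 = complex.Re z ^+ 2 + complex.Im z ^+ 2.
Proof. by rewrite /cmod normc_def sqr_sqrtr // addr_ge0 // sqr_ge0. Qed.

Lemma cmodM z w : cmod (z * w) = cmod z * cmod w.
Proof.
by apply: (@complexI R); rewrite rmorphM /= !cmodE normrM.
Qed.

Lemma cmodX z n : cmod (z ^+ n) = cmod z ^+ n.
Proof.
by apply: (@complexI R); rewrite rmorphXn /= !cmodE normrX.
Qed.

Lemma cmod_prod (I : finType) (F : I -> R[i]) :
  cmod (\prod_i F i) = \prod_i cmod (F i).
Proof.
apply: (@complexI R); rewrite rmorph_prod /= cmodE normr_prod.
by apply: eq_bigr => i _; rewrite cmodE.
Qed.

Lemma ler_normRe_cmod z : `|complex.Re z| <= cmod z.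
Proof.
rewrite -(@ler_pXn2r _ 2) ?nnegrE ?cmod_ge0 // cmod_sqr.
by rewrite real_normK ?num_real // lerDl sqr_ge0.
Qed.

Lemma ler_normIm_cmod z : `|complex.Im z| <= cmod z.
Proof.
rewrite -(@ler_pXn2r _ 2) ?nnegrE ?cmod_ge0 // cmod_sqr.
by rewrite real_normK ?num_real // lerDr sqr_ge0.
Qed.

Lemma cmod_conj z : cmod z^*%C = cmod z.
Proof. by rewrite /cmod normcJ. Qed.

Lemma expiD (x y : R) : expi (x + y) = expi x * expi y.
Proof.
apply/eqP; rewrite /expi cosD sinD eq_complex /=.
by apply/andP; split; apply/eqP; ring.
Qed.

Lemma expi_sum (I : finType) (F : I -> R) :
  expi (\sum_i F i) = \prod_i expi (F i).
Proof.
elim/big_rec2: _ => [|i y x _ <-]; last by rewrite expiD.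
by rewrite /expi cos0 sin0.
Qed.

Lemma cmod_expi (x : R) : cmod (expi x) = 1.
Proof.
apply/eqP; rewrite -(@eqrXn2 _ 2) ?cmod_ge0 // expr1n.
by rewrite cmod_sqr /= cos2Dsin2.
Qed.

Lemma exp_sumD (N : nat) (c : 'I_N -> R[i]) (phi : 'I_N -> R) (x y : R) :
  exp_sum c phi (x + y) = exp_sum (fun n => c n * expi (y * phi n)) phi x.
Proof.
by apply: eq_bigr => n _; rewrite mulrDl expiD -mulrA [expi (y * _) * _]mulrC.
Qed.

End complex_modulus.

Section quadratic_sums.
Context {R : realType}.

Lemma sum_inv_sqr (n : nat) : \sum_(1 <= k < n) (k%:R ^- 2 : R) <= 2.
Proof.
case: n => [|[|n]]; try by rewrite big_geq.
suff: \sum_(1 <= k < n.+2) (k%:R ^- 2 : R) <= 2 - n.+1%:R^-1.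
  by move/le_trans; apply; rewrite lerBlDr lerDl invr_ge0.
elim: n => [|n IH]; first by rewrite big_nat1 expr1n invr1; lra.
rewrite big_nat_recr //=; apply: (le_trans (lerD IH (lexx _))).
rewrite -[n.+2]addn1 natrD; set x : R := n.+1%:R.
have x1 : 1 <= x by rewrite ler1n.
rewrite -subr_ge0.
have -> : 2 - (x + 1)^-1 - (2 - x^-1 + (x + 1) ^- 2) = x^-1 * (x + 1) ^- 2.
  by field; rewrite !gt_eqF //; lra.
by rewrite mulr_ge0 ?invr_ge0 ?exprn_ge0 //; lra.
Qed.

(* The points in one bin [n, n+1) are at mutual distance < 1. *)
Lemma sum_inv_sqr_spaced (I : finType) (A : {pred I}) (x : I -> R) (M : nat) :
  (forall i, i \in A -> 1 <= x i) ->
  (forall i, (#|[pred j | (`|x j - x i| < 1)%R]| <= M)%N) ->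
  \sum_(i in A) x i ^- 2 <= 2 * M%:R.
Proof.
move=> x1 xM.
pose K := (\max_(i in A) Num.truncn (x i))%N.
pose f i : 'I_K.+1 := inord (Num.truncn (x i)).
have fE i : i \in A -> f i = Num.truncn (x i) :> nat.
  by move=> iA; rewrite inordK // ltnS /K (bigD1 i) //= leq_maxl.
rewrite (partition_big f xpredT) //=.
apply: (@le_trans _ _ (\sum_(k < K.+1 | (0 < k)%N) (k%:R ^- 2 * M%:R))); last first.
  rewrite -mulr_suml; apply: ler_wpM2r => //.
  rewrite big_mkcond big_ord_recl /= add0r.
  by have := sum_inv_sqr K.+1; rewrite big_add1 /= big_mkord.
rewrite [leRHS]big_mkcond; apply: ler_sum => k _.
have [k0|] := ltnP; last first.
  rewrite leqn0 => /eqP k0; rewrite big1 // => i /andP[iA /eqP fi].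
  have := x1 i iA; rewrite -truncn_gt0 -fE // fi k0 //.
have [i iP|P0] := pickP (fun i => (i \in A) && (f i == k)); last first.
  by rewrite big_pred0 // mulr_ge0 // invr_ge0 exprn_ge0.
apply: (@le_trans _ _ (\sum_(j | (j \in A) && (f j == k)) k%:R ^- 2)).
  apply: ler_sum => j /andP[jA /eqP jk].
  have xj0 : 0 <= x j by rewrite (le_trans _ (x1 _ jA)).
  rewrite lef_pV2 ?posrE ?exprn_gt0 ?ltr0n //; last by rewrite (lt_le_trans _ (x1 _ jA)).
  by rewrite lerXn2r ?nnegrE // -jk fE // truncn_le.
rewrite sumr_const -[leLHS]mulr_natr ler_wpM2l ?invr_ge0 ?exprn_ge0 // ler_nat.
apply: leq_trans (xM i); apply: subset_leq_card; apply/fintype.subsetP => j.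
rewrite !inE => /andP[jA /eqP fj]; case/andP: iP => iA /eqP fi.
have e : Num.truncn (x i) = Num.truncn (x j) by rewrite -!fE // fi fj.
have /andP[] := truncn_itv (le_trans ler01 (x1 _ iA)).
have /andP[] := truncn_itv (le_trans ler01 (x1 _ jA)).
by rewrite -e -addn1 natrD ltr_distl; lra.
Qed.

Lemma sum_inv_sqr_far (I : finType) (lam : I -> R) (d : R) (M : nat) i : 0 < d ->
  (forall i, (#|[pred j | (`|lam j - lam i| < d)%R]| <= M)%N) ->
  \sum_(j | d <= `|lam i - lam j|) (lam i - lam j) ^- 2 <= 4 * M%:R / d ^+ 2.
Proof.
move=> d0 lamM.
have one_side (s : R) : s ^+ 2 = 1 ->
    \sum_(j in [pred j | d <= s * (lam i - lam j)]) (lam i - lam j) ^- 2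
    <= 2 * M%:R / d ^+ 2.
  move=> s1; pose x j := s * (lam i - lam j) / d.
  have ns : `|s| = 1.
    by apply/eqP; rewrite -(@eqrXn2 _ 2) // expr1n real_normK ?num_real // s1.
  rewrite (eq_bigr (fun j => x j ^- 2 * d ^- 2)); last first.
    move=> j _; rewrite /x !exprMn s1 mul1r exprVn -invfM mulfVK //.
    by rewrite expf_eq0 /= gt_eqF.
  rewrite -mulr_suml ler_wpM2r ?invr_ge0 ?exprn_ge0 ?(ltW d0) //.
  apply: sum_inv_sqr_spaced => [j|j].
    by rewrite inE /x ler_pdivlMr ?mul1r.
  apply: leq_trans (lamM j); apply: subset_leq_card; apply/fintype.subsetP => k.
  rewrite !inE /x -mulrBl -mulrBr !normrM ns mul1r normfV (gtr0_norm d0).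
  by rewrite ltr_pdivrMr // mul1r distrC; congr (`|_| < _); ring.
have := lerD (one_side 1 (expr1n _ _)) (one_side (-1) (etrans (sqrrN 1) (expr1n _ _))).
have -> : 2 * M%:R / d ^+ 2 + 2 * M%:R / d ^+ 2 = 4 * M%:R / d ^+ 2.
  by rewrite -mulrDl -mulrDl; congr (_ * _ / _); ring.
apply: le_trans.
rewrite 3![X in _ <= X + _]big_mkcond [X in _ <= _ + X]big_mkcond -big_split.
rewrite big_mkcond; apply: ler_sum => j _ /=; rewrite !inE.
have p0 : 0 <= (lam i - lam j) ^- 2 by rewrite invr_ge0 sqr_ge0.
rewrite mul1r mulN1r ler_normr.
by case: (d <= _ - _); case: (d <= - _) => /=; lra.
Qed.

Lemma schur_test (I : finType) (u : I -> R) (K : I -> I -> R) (B : R) :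
  (forall i j, 0 <= K i j) -> (forall i j, K i j = K j i) ->
  (forall i, \sum_j K i j <= B) ->
  \sum_i \sum_j u i * u j * K i j <= B * \sum_i u i ^+ 2.
Proof.
move=> K0 Ks KB.
apply: (@le_trans _ _ (\sum_i \sum_j 2^-1 * (u i ^+ 2 * K i j + u j ^+ 2 * K i j))).
  apply: ler_sum => i _; apply: ler_sum => j _.
  have := K0 i j; have := sqr_ge0 (u i - u j); nra.
have -> : \sum_i \sum_j 2^-1 * (u i ^+ 2 * K i j + u j ^+ 2 * K i j) =
    \sum_i u i ^+ 2 * \sum_j K i j.
  transitivity (2^-1 * (\sum_i \sum_j u i ^+ 2 * K i j + \sum_i \sum_j u j ^+ 2 * K i j)).
    rewrite -big_split mulr_sumr; apply: eq_bigr => i _.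
    by rewrite -big_split mulr_sumr.
  rewrite [X in _ + X]exchange_big /=.
  rewrite (eq_bigr (fun i => u i ^+ 2 * \sum_j K i j)); last by move=> i _; rewrite mulr_sumr.
  rewrite [X in _ + X](eq_bigr (fun i => u i ^+ 2 * \sum_j K i j)); first by field.
  by move=> i _; rewrite mulr_sumr; apply: eq_bigr => j _; rewrite Ks.
by rewrite mulr_sumr; apply: ler_sum => i _; rewrite mulrC ler_wpM2r ?sqr_ge0.
Qed.

End quadratic_sums.

Section integral_bounds.
Context {R : realType}.
Notation mu := (@lebesgue_measure R).

Lemma is_derive_continuous (f df : R -> R) :
  (forall t : R, is_derive t (1 : R) f (df t)) -> continuous f.
Proof.
move=> dfE t.
by apply/differentiable_continuous/derivable1_diffP; exact: ex_derive.
Qed.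

(* Unlike [ge0_le_integral], no measurability is required. *)
Lemma ge0_le_integral_nonmeasurable d (T : measurableType d)
    (m : {measure set T -> \bar R}) (D : set T) (f g : T -> \bar R) :
  (forall x, D x -> 0 <= f x)%E -> (forall x, D x -> f x <= g x)%E ->
  (\int[m]_(x in D) f x <= \int[m]_(x in D) g x)%E.
Proof.
move=> f0 fg; have g0 x : D x -> (0 <= g x)%E.
  by move=> Dx; exact: le_trans (f0 _ Dx) (fg _ Dx).
rewrite !ge0_integralE //; apply: le_ereal_sup => _ [h hf <-].
exists h => // x; apply: le_trans (hf x) _.
by rewrite /patch; case: ifPn => // /set_mem; exact: fg.
Qed.

Lemma le_integral_primitive (f h H : R -> R) (a b : R) (D : set R) :
  a < b -> D `<=` `[a, b] -> measurable D ->
  (forall t, D t -> 0 <= f t <= h t) ->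
  (forall t, t \in `[a, b] -> 0 <= h t) ->
  continuous h -> (forall t, is_derive t (1 : R) H (h t)) ->
  (\int[mu]_(t in D) (f t)%:E <= (H b - H a)%:E)%E.
Proof.
move=> ab Dab mD fh h0 ch dH.
apply: (@le_trans _ _ (\int[mu]_(t in D) (h t)%:E)%E).
  by apply: ge0_le_integral_nonmeasurable => t /fh /andP[]; rewrite !lee_fin.
have cH := is_derive_continuous dH.
apply: (@le_trans _ _ (\int[mu]_(t in `[a, b]) (h t)%:E)%E).
  apply: ge0_subset_integral => //.
    apply/measurable_EFinP; apply: measurable_funTS.
    exact: continuous_measurable_fun.
rewrite (@continuous_FTC2 _ h H) //.
- by apply: continuous_subspaceT.
- split => //.
  + exact/cvg_at_right_filter/cH.
  + exact/cvg_at_left_filter/cH.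
- by move=> t _; rewrite derive1E; exact: derive_val.
Qed.

End integral_bounds.

Section trigonometric_derivatives.
Context {R : realType}.
Implicit Types (z : R[i]) (m t : R).

Lemma is_derive_Re_expi z m t :
  is_derive t (1 : R) (fun t => complex.Re (z * expi (t * m)))
    (- m * complex.Im (z * expi (t * m))).
Proof.
case: z => a b /=.
have dm : is_derive t (1 : R) (fun t => t * m) m.
  by apply: is_derive_eq; rewrite /GRing.scale /=; ring.
have dc : is_derive t (1 : R) (fun t => cos (t * m)) (- m * sin (t * m)).
  have := @is_derive1_comp _ cos (fun t => t * m) t _ _ _ dm.
  move=> /(_ _ (is_derive_cos _)) h; apply: is_derive_eq h _.
  ring.
have ds : is_derive t (1 : R) (fun t => sin (t * m)) (m * cos (t * m)).
  have := @is_derive1_comp _ sin (fun t => t * m) t _ _ _ dm.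
  move=> /(_ _ (is_derive_sin _)) h; apply: is_derive_eq h _.
  ring.
by apply: is_derive_eq; rewrite /GRing.scale /=; ring.
Qed.

Lemma is_derive_Im_expi z m t :
  is_derive t (1 : R) (fun t => complex.Im (z * expi (t * m)))
    (m * complex.Re (z * expi (t * m))).
Proof.
have := is_derive_Re_expi (z * - 'i%C) m t.
rewrite (_ : (fun t0 : R => _) = (fun t => complex.Im (z * expi (t * m)))); last first.
  by apply/funext => s; case: z => a b /=; ring.
by move=> h; apply: is_derive_eq h _; case: z => a b /=; ring.
Qed.

Lemma is_derive_fsum (I : finType) (P : pred I) (f : I -> R -> R) (df : I -> R) t :
  (forall i, P i -> is_derive t (1 : R) (f i) (df i)) ->
  is_derive t (1 : R) (fun s => \sum_(i | P i) f i s) (\sum_(i | P i) df i).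
Proof.
move=> h.
have -> : (fun s => \sum_(i | P i) f i s) = \sum_(i | P i) f i.
  by apply/funext => s; rewrite fct_sumE.
elim/big_rec2 : _ => [|i y x Pi yx]; first exact: is_derive_cst.
by have := h i Pi => hi; exact: is_deriveD.
Qed.

(* Primitive of [(T^2 - (t - x)^2) Re (z exp (i t m))] in [t], obtained by
   repeated integration by parts; the weight is a parabola so that the process
   stops. *)
Definition parabola_primitive z m (T x : R) t :=
  (T ^+ 2 - (t - x) ^+ 2) * (complex.Im (z * expi (t * m)) / m)
  - 2 * (t - x) * (complex.Re (z * expi (t * m)) / m ^+ 2)
  + 2 * (complex.Im (z * expi (t * m)) / m ^+ 3).

Lemma is_derive_parabola_primitive z m (T x : R) t : m != 0 ->
  is_derive t (1 : R) (parabola_primitive z m T x)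
    ((T ^+ 2 - (t - x) ^+ 2) * complex.Re (z * expi (t * m))).
Proof.
move=> m0; rewrite /parabola_primitive.
have dp := is_derive_Re_expi z m t.
have dr := is_derive_Im_expi z m t.
by apply: is_derive_eq; rewrite /GRing.scale /=; field.
Qed.

End trigonometric_derivatives.

Section mean_value.
Context {R : realType}.
Notation mu := (@lebesgue_measure R).

Lemma cmod_sum_sqr (I : finType) (a : I -> R[i]) (lam : I -> R) (t : R) :
  cmod (\sum_i a i * expi (t * lam i)) ^+ 2 =
  \sum_i \sum_j complex.Re (a i * (a j)^*%C * expi (t * (lam i - lam j))).
Proof.
have -> z : cmod z ^+ 2 = complex.Re (z * z^*%C) :> R.
  by rewrite cmod_sqr; case: z => x y /=; ring.
rewrite mulr_suml raddf_sum; apply: eq_bigr => i _.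
rewrite rmorph_sum mulr_sumr raddf_sum; apply: eq_bigr => j _.
rewrite rmorphM /= mulrBr expiD mulrACA; congr (complex.Re (_ * (_ * _))).
by rewrite /expi cosN sinN.
Qed.

Lemma parabola_primitive_endpoints (z : R[i]) (m T x : R) : 1 <= `|m| * T ->
  parabola_primitive z m T x (x + T) - parabola_primitive z m T x (x - T)
  <= cmod z * (8 * T / m ^+ 2).
Proof.
move=> mT; set F := parabola_primitive z m T x.
have m0 : m != 0 by apply: contraTneq mT => ->; rewrite normr0 mul0r ler10.
have nm0 : 0 < `|m| by rewrite normr_gt0.
have T0 : 0 < T by rewrite -(pmulr_rgt0 _ nm0); exact: lt_le_trans mT.
pose p (t : R) := complex.Re (z * expi (t * m)).
pose r (t : R) := complex.Im (z * expi (t * m)).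
have pb t : `|p t| <= cmod z.
  by rewrite (le_trans (ler_normRe_cmod _)) // cmodM cmod_expi mulr1.
have rb t : `|r t| <= cmod z.
  by rewrite (le_trans (ler_normIm_cmod _)) // cmodM cmod_expi mulr1.
have -> : F (x + T) - F (x - T) =
    (- 2 * T * (p (x + T) + p (x - T)) + 2 * ((r (x + T) - r (x - T)) / m)) / m ^+ 2.
  by rewrite /F /parabola_primitive /p /r; field.
rewrite [leRHS]mulrA ler_pM2r ?invr_gt0 ?exprn_even_gt0 //.
have rT t : `|r t / m| <= cmod z * T.
  rewrite normrM normfV ler_pdivrMr // -mulrA (le_trans (rb t)) //.
  by rewrite ler_peMr ?cmod_ge0 // mulrC.
have pT t : `|T * p t| <= cmod z * T.
  by rewrite normrM gtr0_norm // mulrC ler_wpM2r // ltW.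
have := rT (x + T); have := rT (x - T); have := pT (x + T); have := pT (x - T).
rewrite !ler_norml mulrBl => /andP[? ?] /andP[? ?] /andP[? ?] /andP[? ?].
by lra.
Qed.

Lemma mean_value (I : finType) (a : I -> R[i]) (lam : I -> R) (d T x : R) (M : nat) :
  0 < d -> 0 < T ->
  (forall i, (#|[pred j | (`|lam j - lam i| < d)%R]| <= M)%N) ->
  (\int[mu]_(t in `[(x - T)%R, (x + T)%R]) (cmod (\sum_i a i * expi (t * lam i)) ^+ 2)%:E
   <= (32 * M%:R * (T + d^-1) * \sum_i cmod (a i) ^+ 2)%:E)%E.
Proof.
move=> d0 T0 lamM.
pose X := T + d^-1; pose T1 := 2 * X.
have d'0 : 0 < d^-1 by rewrite invr_gt0.
have X0 : 0 < X by rewrite addr_gt0.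
have T10 : 0 < T1 by rewrite mulr_gt0.
pose u i := cmod (a i).
pose z i j := a i * (a j)^*%C.
pose m i j := lam i - lam j.
have cz i j : cmod (z i j) = u i * u j by rewrite cmodM cmod_conj.
pose k0 := 4 / (3 * T1 ^+ 2).
have k00 : 0 < k0 by rewrite divr_gt0 // mulr_gt0 // exprn_gt0.
pose w t := T1 ^+ 2 - (t - x) ^+ 2.
pose Cst := \sum_i \sum_(j | `|m i j| < d) u i * u j.
pose Sf t := \sum_i \sum_(j | d <= `|m i j|) complex.Re (z i j * expi (t * m i j)).
pose F i j := parabola_primitive (z i j) (m i j) T1 x.
pose SF t := \sum_i \sum_(j | d <= `|m i j|) F i j t.
pose A t := cmod (\sum_i a i * expi (t * lam i)) ^+ 2.
have A_le t : A t <= Cst + Sf t.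
  rewrite /A cmod_sum_sqr -big_split; apply: ler_sum => i _ /=.
  rewrite (bigID (fun j => `|m i j| < d)) /= lerD //.
    apply: ler_sum => j _; rewrite -cz (le_trans (ler_norm _)) //.
    by rewrite (le_trans (ler_normRe_cmod _)) // cmodM cmod_expi mulr1.
  by rewrite (eq_bigl (fun j => d <= `|m i j|)) // => j; rewrite -leNgt.
have A0 t : 0 <= A t by exact: sqr_ge0.
have dSF t : is_derive t (1 : R) SF (w t * Sf t).
  rewrite /Sf mulr_sumr; apply: is_derive_fsum => i _.
  rewrite mulr_sumr; apply: is_derive_fsum => j dij.
  apply: is_derive_parabola_primitive.
  by rewrite -normr_gt0 (lt_le_trans d0).
pose dSf t := \sum_i \sum_(j | d <= `|m i j|)
  (- m i j * complex.Im (z i j * expi (t * m i j))).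
have dSfE t : is_derive t (1 : R) Sf (dSf t).
  apply: is_derive_fsum => i _; apply: is_derive_fsum => j _.
  exact: is_derive_Re_expi.
pose h t := k0 * (w t * (Cst + Sf t)).
pose H t := k0 * (Cst * (T1 ^+ 2 * t - (t - x) ^+ 3 / 3) + SF t).
have ch : continuous h.
  pose dh t := k0 * (- 2 * (t - x) * (Cst + Sf t) + w t * dSf t).
  apply: (@is_derive_continuous _ h dh) => t; rewrite /dh.
  by rewrite /h /w; apply: is_derive_eq; rewrite /GRing.scale /=; ring.
have dH t : is_derive t (1 : R) H (h t).
  by rewrite /H /h /w; apply: is_derive_eq; rewrite /GRing.scale /= /w; field.
have wE t : w t = (T1 - (t - x)) * (T1 + (t - x)) by rewrite /w; ring.
apply: (@le_trans _ _ (H (x + T1) - H (x - T1))%:E).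
  apply: (@le_integral_primitive _ A h) => //.
  - lra.
  - by move=> t /=; rewrite !in_itv /= /T1 /X => /andP[? ?]; apply/andP; split; lra.
  - move=> t /=; rewrite in_itv /= => /andP[? ?]; rewrite A0 /=.
    rewrite /h mulrA (le_trans (A_le t)) // ler_peMl ?(le_trans (A0 t)) //.
    rewrite /k0 mulrAC ler_pdivlMr ?mulr_gt0 ?exprn_gt0 // mul1r wE.
    rewrite /T1 /X.
    nra.
  - move=> t; rewrite in_itv /= => /andP[? ?].
    have ? := le_trans (A0 t) (A_le t).
    by rewrite /h mulr_ge0 ?(ltW k00) // mulr_ge0 // wE mulr_ge0 //; lra.
rewrite lee_fin.
pose K i j := if `|m i j| < d then 16 / 9 * T1 else 32 / 3 / T1 * m i j ^- 2.
apply: (@le_trans _ _ (\sum_i \sum_j u i * u j * K i j)).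
  have -> : H (x + T1) - H (x - T1) =
     k0 * (4 / 3 * T1 ^+ 3) * Cst + k0 * (SF (x + T1) - SF (x - T1)).
    by rewrite /H; field.
  rewrite /Cst /SF -sumrB !mulr_sumr -big_split; apply: ler_sum => i _ /=.
  rewrite -sumrB !mulr_sumr [leRHS](bigID (fun j => `|m i j| < d)) /= lerD //.
    apply: ler_sum => j ij; rewrite /K ij /k0 le_eqVlt; apply/orP; left; apply/eqP.
    by field; rewrite gt_eqF.
  rewrite [leRHS](eq_bigl (fun j => d <= `|m i j|)); last by move=> j; rewrite -leNgt.
  apply: ler_sum => j ij; rewrite /K ltNge ij /=.
  have mT : 1 <= `|m i j| * T1.
    rewrite -(mulfV (lt0r_neq0 d0)) ler_pM ?(ltW d0) ?(ltW d'0) //.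
    by rewrite /T1 /X; lra.
  apply: le_trans (ler_wpM2l (ltW k00) (parabola_primitive_endpoints (z i j) x mT)) _.
  rewrite cz /k0 le_eqVlt; apply/orP; left; apply/eqP; field.
  by rewrite -normr_gt0 (lt_le_trans d0) //= gt_eqF.
apply: le_trans (@schur_test _ _ u K (32 * M%:R * X) _ _ _) _ => //.
- move=> i j; rewrite /K.
  by case: ifP => _; rewrite mulr_ge0 ?divr_ge0 ?invr_ge0 ?sqr_ge0 // ltW.
- by move=> i j; rewrite /K /m distrC -(sqrrN (lam i - _)) opprB.
move=> i; rewrite /K (bigID (fun j => `|m i j| < d)) /=.
rewrite (eq_bigr (fun=> 16 / 9 * T1)); last by move=> j ->.
rewrite [X in _ + X](eq_bigl (fun j => d <= `|m i j|)); last by move=> j; rewrite -leNgt.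
rewrite [X in _ + X](eq_bigr (fun j => 32 / 3 / T1 * m i j ^- 2)); last first.
  by move=> j; rewrite ltNge => ->.
rewrite -[X in _ + X]mulr_sumr.
have h1 : \sum_(j | `|m i j| < d) (16 / 9 * T1) <= 16 / 9 * T1 * M%:R.
  rewrite sumr_const -[leLHS]mulr_natr; apply: ler_wpM2l; first by lra.
  rewrite ler_nat.
  apply: leq_trans (lamM i); apply: subset_leq_card; apply/fintype.subsetP => j.
  by rewrite !inE /m distrC.
have h2 := sum_inv_sqr_far i d0 lamM.
have c0 : 0 <= 32 / 3 / T1 by rewrite divr_ge0 ?(ltW T10).
apply: le_trans (lerD h1 (ler_wpM2l c0 h2)) _.
have e : d^-1 ^+ 2 <= X ^+ 2.
  by rewrite lerXn2r ?nnegrE ?(ltW d'0) ?(ltW X0) // /X; lra.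
have e2 : d^-1 ^+ 2 / X <= X by rewrite ler_pdivrMr // -expr2.
have -> : 16 / 9 * T1 * M%:R + 32 / 3 / T1 * (4 * M%:R / d ^+ 2) =
   M%:R * (32 / 9 * X + 64 / 3 * (d^-1 ^+ 2 / X)).
  by rewrite /T1; field; rewrite !gt_eqF.
have M0 : 0 <= M%:R :> R by [].
have -> : 32 * M%:R * X = M%:R * (32 * X) by ring.
by rewrite ler_wpM2l //; lra.
Qed.

End mean_value.

Section moments.
Context {R : realType}.
Notation mu := (@lebesgue_measure R).

Definition deriv_coef (N : nat) (c : 'I_N -> R[i]) (phi : 'I_N -> R) (n : 'I_N) : R[i] :=
  c n * (0 +i* phi n)%C.

Lemma cmod_deriv_coef_sqr (N : nat) (c : 'I_N -> R[i]) (phi : 'I_N -> R) n :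
  cmod (deriv_coef c phi n) ^+ 2 = cmod (c n) ^+ 2 * phi n ^+ 2.
Proof.
rewrite /deriv_coef cmodM exprMn [cmod (_ +i* _)%C ^+ 2]cmod_sqr /=.
by rewrite expr0n add0r.
Qed.

Lemma is_derive_Re_exp_sum (N : nat) (c : 'I_N -> R[i]) (phi : 'I_N -> R) (t : R) :
  is_derive t (1 : R) (fun t => complex.Re (exp_sum c phi t))
    (complex.Re (exp_sum (deriv_coef c phi) phi t)).
Proof.
have -> : (fun t => complex.Re (exp_sum c phi t)) =
    (fun t => \sum_n complex.Re (c n * expi (t * phi n))).
  by apply/funext => s; rewrite raddf_sum.
rewrite raddf_sum; apply: is_derive_fsum => n _.
apply: is_derive_eq (is_derive_Re_expi _ _ _) _.
by rewrite /deriv_coef; case: (c n) => x y /=; ring.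
Qed.

Lemma is_derive_Im_exp_sum (N : nat) (c : 'I_N -> R[i]) (phi : 'I_N -> R) (t : R) :
  is_derive t (1 : R) (fun t => complex.Im (exp_sum c phi t))
    (complex.Im (exp_sum (deriv_coef c phi) phi t)).
Proof.
have -> : (fun t => complex.Im (exp_sum c phi t)) =
    (fun t => \sum_n complex.Im (c n * expi (t * phi n))).
  by apply/funext => s; rewrite raddf_sum.
rewrite raddf_sum; apply: is_derive_fsum => n _.
apply: is_derive_eq (is_derive_Im_expi _ _ _) _.
by rewrite /deriv_coef; case: (c n) => x y /=; ring.
Qed.

Definition deriv_cmod_exp_sum (N q : nat) (c : 'I_N -> R[i]) (phi : 'I_N -> R) (t : R) :=
  let P := exp_sum c phi t in
  let P' := exp_sum (deriv_coef c phi) phi t in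
  q%:R * cmod P ^+ (2 * q.-1) *
     (2 * (complex.Re P * complex.Re P' + complex.Im P * complex.Im P')).

Lemma is_derive_cmod_exp_sum (N q : nat) (c : 'I_N -> R[i]) (phi : 'I_N -> R) (t : R) :
  is_derive t (1 : R) (fun t => cmod (exp_sum c phi t) ^+ (2 * q))
    (deriv_cmod_exp_sum q c phi t).
Proof.
rewrite /deriv_cmod_exp_sum /=; set P := exp_sum c phi t.
set P' := exp_sum (deriv_coef c phi) phi t.
have dU := is_derive_Re_exp_sum c phi t.
have dV := is_derive_Im_exp_sum c phi t.
have -> : (fun t => cmod (exp_sum c phi t) ^+ (2 * q)) =
    (fun t => (complex.Re (exp_sum c phi t) ^+ 2 + complex.Im (exp_sum c phi t) ^+ 2) ^+ q).
  by apply/funext => s; rewrite exprM cmod_sqr.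
have dUV := @is_deriveX R _ (fun t => complex.Re (exp_sum c phi t) ^+ 2 +
  complex.Im (exp_sum c phi t) ^+ 2) q t 1
  (2 * (complex.Re P * complex.Re P' + complex.Im P * complex.Im P')).
rewrite -exprfctE; apply: is_derive_eq (dUV _) _.
  by apply: is_derive_eq; rewrite /GRing.scale /= -/P -/P'; ring.
by rewrite exprM cmod_sqr /GRing.scale /= -mulr_natl; ring.
Qed.

Lemma continuous_cmod_exp_sum (N q : nat) (c : 'I_N -> R[i]) (phi : 'I_N -> R) :
  continuous (fun t => cmod (exp_sum c phi t) ^+ (2 * q)).
Proof. exact: is_derive_continuous (@is_derive_cmod_exp_sum N q c phi). Qed.

Lemma continuous_deriv_cmod_exp_sum (N q : nat) (c : 'I_N -> R[i]) (phi : 'I_N -> R) :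
  continuous (deriv_cmod_exp_sum q c phi).
Proof.
have cRe c' := is_derive_continuous (@is_derive_Re_exp_sum N c' phi).
have cIm c' := is_derive_continuous (@is_derive_Im_exp_sum N c' phi).
move=> t; apply: cvgM.
  by apply: cvgM; [exact: cvg_cst|exact: continuous_cmod_exp_sum].
apply: cvgM; first exact: cvg_cst.
by apply: cvgD; apply: cvgM; (exact: cRe || exact: cIm).
Qed.

(* Young's inequality, with [d] balancing the two terms. *)
Lemma deriv_cmod_exp_sum_le (N q : nat) (c : 'I_N -> R[i]) (phi : 'I_N -> R) (d t : R) :
  0 < d ->
  deriv_cmod_exp_sum q c phi t <=
  2 * q%:R / d * (cmod (exp_sum c phi t) ^+ (2 * q)
    + d ^+ (2 * q) * cmod (exp_sum (deriv_coef c phi) phi t) ^+ (2 * q)).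
Proof.
move=> d0; rewrite /deriv_cmod_exp_sum /=; set P := exp_sum c phi t.
set P' := exp_sum (deriv_coef c phi) phi t.
case: q => [|q]; first by rewrite !mulr0n !mulr0 !mul0r.
have cs : complex.Re P * complex.Re P' + complex.Im P * complex.Im P' <= cmod P * cmod P'.
  rewrite -(cmod_conj P') -cmodM; apply: le_trans (ler_normRe_cmod _).
  by apply: le_trans (ler_norm _); case: (P) (P') => x y [x' y'] /=; lra.
have young : cmod P ^+ (2 * q).+1 * (d * cmod P') <=
    cmod P ^+ (2 * q).+2 + (d * cmod P') ^+ (2 * q).+2.
  have x0 := cmod_ge0 P.
  have z0 : 0 <= d * cmod P' by rewrite mulr_ge0 ?cmod_ge0 // ltW.
  move: x0 z0; set x := cmod P; set z := d * cmod P' => x0 z0.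
  have [xz|/ltW zx] := leP x z.
    apply: (@le_trans _ _ (z ^+ (2 * q).+2)); last by rewrite lerDr exprn_ge0.
    by rewrite [leRHS]exprSr; apply: ler_wpM2r => //; rewrite lerXn2r ?nnegrE.
  apply: (@le_trans _ _ (x ^+ (2 * q).+2)); last by rewrite lerDl exprn_ge0.
  by rewrite [leRHS]exprSr ler_wpM2l // exprn_ge0.
have e2 : (2 * q.+1)%N = (2 * q).+2 by rewrite mulnS.
rewrite e2 -exprMn.
have q0 : 0 <= 2 * q.+1%:R / d :> R by rewrite divr_ge0 ?mulr_ge0 // ltW.
apply: le_trans (ler_wpM2l q0 young).
have -> : 2 * q.+1%:R / d * (cmod P ^+ (2 * q).+1 * (d * cmod P')) =
   q.+1%:R * cmod P ^+ (2 * q) * (2 * (cmod P * cmod P')).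
  by rewrite exprS; field; rewrite gt_eqF.
rewrite ler_wpM2l ?mulr_ge0 ?exprn_ge0 ?cmod_ge0 //.
by rewrite ler_wpM2l.
Qed.

Lemma exp_sum_expn (N q : nat) (c : 'I_N -> R[i]) (phi : 'I_N -> R) (t : R) :
  exp_sum c phi t ^+ q =
  \sum_(f : {ffun 'I_q -> 'I_N})
    (\prod_i c (f i)) * expi (t * \sum_i phi (f i)).
Proof.
rewrite -[q in LHS]card_ord -prodr_const bigA_distr_bigA.
apply: eq_bigr => f _; rewrite big_split /= mulr_sumr expi_sum.
by [].
Qed.

Lemma sum_cmod_prod_sqr (N q : nat) (c : 'I_N -> R[i]) :
  \sum_(f : {ffun 'I_q -> 'I_N}) cmod (\prod_i c (f i)) ^+ 2 =
  (\sum_n cmod (c n) ^+ 2) ^+ q.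
Proof.
rewrite -[q in RHS]card_ord -prodr_const bigA_distr_bigA.
by apply: eq_bigr => f _; rewrite cmod_prod prodrXl.
Qed.

Definition fiber_sizes (N q : nat) (f : {ffun 'I_q -> 'I_N}) : {ffun 'I_N -> nat} :=
  [ffun n => #|[pred i | f i == n]|].

Lemma sum_fiber_sizes (N q : nat) (f : {ffun 'I_q -> 'I_N}) :
  simplex_pts q (fiber_sizes f).
Proof.
rewrite /simplex_pts /= -[RHS]card_ord -sum1_card (partition_big f xpredT) //=.
by apply: eq_bigr => n _; rewrite ffunE -sum1_card.
Qed.

Lemma sum_freq_fiber_sizes (N q : nat) (phi : 'I_N -> R) (f : {ffun 'I_q -> 'I_N}) :
  \sum_i phi (f i) = \sum_n (fiber_sizes f n)%:R * phi n.
Proof.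
rewrite (partition_big f xpredT) //=; apply: eq_bigr => n _.
rewrite (eq_bigr (fun=> phi n)) => [|i /eqP -> //].
by rewrite sumr_const ffunE mulr_natl.
Qed.

(* Functions with the same fiber sizes differ by a reindexing of ['I_q]. *)
Lemma card_same_fiber_sizes (N q : nat) (f : {ffun 'I_q -> 'I_N}) :
  (#|[pred g : {ffun 'I_q -> 'I_N} | fiber_sizes g == fiber_sizes f]| <= q ^ q)%N.
Proof.
pose F (s : {ffun 'I_q -> 'I_q}) := [ffun i => f (s i)].
have -> : (q ^ q)%N = #|{ffun 'I_q -> 'I_q}| by rewrite card_ffun card_ord.
apply: leq_trans (leq_image_card F xpredT).
apply: subset_leq_card; apply/fintype.subsetP => g; rewrite inE => /eqP gf.
have s_ex i : {k | f k == g i}.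
  apply: sigW.
  have : (0 < fiber_sizes f (g i))%N.
    by rewrite -gf ffunE; apply/card_gt0P; exists i; rewrite inE.
  by rewrite ffunE => /card_gt0P[k]; exists k.
apply/fintype.imageP; exists [ffun i => sval (s_ex i)] => //.
by apply/ffunP => i; rewrite !ffunE; apply/esym/eqP; case: (s_ex i).
Qed.

Lemma card_near_freq (N q : nat) (phi : 'I_N -> R) (d : R)
    (f : {ffun 'I_q -> 'I_N}) :
  (d%:E <= lin_spacing phi q)%E ->
  (#|[pred g : {ffun 'I_q -> 'I_N} |
       (`|\sum_i phi (g i) - \sum_i phi (f i)| < d)%R]| <= q ^ q)%N.
Proof.
move=> dxi; apply: leq_trans (card_same_fiber_sizes f).
apply: subset_leq_card; apply/fintype.subsetP => g; rewrite !inE => gfd.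
apply: contraTT gfd => gf; rewrite -leNgt -lee_fin (le_trans dxi) //.
apply: ereal_inf_lbound; exists (fiber_sizes g), (fiber_sizes f); split => //.
- exact: sum_fiber_sizes.
- exact: sum_fiber_sizes.
- rewrite !sum_freq_fiber_sizes -sumrB.
  by congr (`|_|%:E); apply: eq_bigr => n _; rewrite mulrBl.
Qed.

Lemma exp_sum_moment (N q : nat) (c : 'I_N -> R[i]) (phi : 'I_N -> R)
    (d T a b : R) (J : set R) : measurable J ->
  0 < d -> (d%:E <= lin_spacing phi q)%E -> 0 < T -> J `<=` `[a, a + T] ->
  (\int[mu]_(t in J) (cmod (exp_sum c phi (t + b)) ^+ (2 * q))%:E
   <= (32 * (q ^ q)%:R * (T + d^-1) * (\sum_n cmod (c n) ^+ 2) ^+ q)%:E)%E.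
Proof.
move=> mJ d0 dxi T0 JT.
pose c' n := c n * expi (b * phi n).
have -> : \sum_n cmod (c n) ^+ 2 = \sum_n cmod (c' n) ^+ 2.
  by apply: eq_bigr => n _; rewrite /c' cmodM cmod_expi mulr1.
have eE t : cmod (exp_sum c phi (t + b)) ^+ (2 * q) = cmod (exp_sum c' phi t) ^+ (2 * q).
  by rewrite exp_sumD.
under eq_integral do rewrite eE.
rewrite -sum_cmod_prod_sqr.
have := @mean_value R _ (fun f : {ffun 'I_q -> 'I_N} => \prod_i c' (f i))
  (fun f => \sum_i phi (f i)) d T a (q ^ q) d0 T0 (fun f => card_near_freq f dxi).
apply: le_trans.
under [leRHS]eq_integral do rewrite -exp_sum_expn cmodX -exprM mulnC.
apply: ge0_subset_integral => //.
- apply/measurable_EFinP; apply: measurable_funTS; apply: continuous_measurable_fun.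
  exact: continuous_cmod_exp_sum.
- by move=> t _; rewrite lee_fin exprn_ge0 // cmod_ge0.
- by move=> t /JT /=; rewrite !in_itv /= => /andP[? ?]; apply/andP; split; lra.
Qed.

End moments.

Section local_sup.
Context {R : realType}.
Notation mu := (@lebesgue_measure R).

Lemma continuous_segment_integrable (f : R -> R) (a b : R) : continuous f ->
  mu.-integrable `[a, b] (EFin \o f).
Proof.
move=> cf; apply: continuous_compact_integrable; first exact: segment_compact.
exact: continuous_subspaceT.
Qed.

Lemma le_integral_of_derivative (g g' h : R -> R) (a b t : R) :
  a <= t <= b -> continuous g' -> continuous h ->
  (forall s, is_derive s (1 : R) g (g' s)) ->
  (forall s, g' s <= h s) -> (forall s, 0 <= h s) ->
  ((g t)%:E <= (g a)%:E + \int[mu]_(s in `[a, b]) (h s)%:E)%E.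
Proof.
move=> /andP[at_ tb] cg' ch dg gh h0.
have [<-|ta] := eqVneq a t.
  by rewrite leeDl // integral_ge0 // => s _; rewrite lee_fin.
have {ta}at' : a < t by rewrite lt_neqAle ta.
have cg := is_derive_continuous dg.
have E : (\int[mu]_(s in `[a, t]) (g' s)%:E = (g t)%:E - (g a)%:E)%E.
  rewrite (@continuous_FTC2 _ g' g) //.
  - by apply: continuous_subspaceT.
  - split => //.
    + exact/cvg_at_right_filter/cg.
    + exact/cvg_at_left_filter/cg.
  - by move=> s _; rewrite derive1E; exact: derive_val.
have -> : ((g t)%:E = (g a)%:E + \int[mu]_(s in `[a, t]) (g' s)%:E)%E.
  by rewrite E -EFinB -EFinD addrC subrK.
rewrite leeD2l //.
apply: (@le_trans _ _ (\int[mu]_(s in `[a, t]) (h s)%:E)%E).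
  apply: le_integral => //; try exact: continuous_segment_integrable.
  by move=> s _; rewrite lee_fin.
apply: ge0_subset_integral => //.
- apply/measurable_EFinP; apply: measurable_funTS.
  exact: continuous_measurable_fun.
- by move=> s _; rewrite lee_fin.
- by move=> s /=; rewrite !in_itv /= => /andP[-> /=] /le_trans; apply.
Qed.

Lemma measurable_translate_indic (k : R -> R) (A B : set R) :
  measurable A -> measurable B -> continuous k ->
  measurable_fun [set: R * R]
    (fun z => (k (z.1 + z.2) * (\1_A z.1 * \1_B z.2))%:E).
Proof.
move=> mA mB ck; apply/measurable_EFinP; apply: measurable_funM.
  apply: measurableT_comp; first exact: continuous_measurable_fun.
  by apply: measurable_funD.
by apply: measurable_funM; apply: measurableT_comp.
Qed.

Lemma integral_translate_indic (k : R -> R) (A B : set R) (x : R) :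
  (\int[mu]_y (k (x + y) * (\1_A x * \1_B y))%:E =
   ((fun t => \int[mu]_(s in B) (k (t + s))%:E) \_ A) x)%E.
Proof.
rewrite patchE; case: ifPn => xA; last first.
  by apply: integral0_eq => y _; rewrite indicE (negbTE xA) mul0r mulr0.
rewrite [RHS]integral_mkcond; apply: eq_integral => y _; rewrite patchE.
by rewrite !indicE xA mul1r; case: ifPn; rewrite /= ?mulr1 ?mulr0.
Qed.

Lemma measurable_integral_translates (k : R -> R) (a b : R) :
  continuous k -> (forall s, 0 <= k s) ->
  measurable_fun [set: R] (fun t => \int[mu]_(s in `[a, b]) (k (t + s))%:E)%E.
Proof.
move=> ck k0.
pose f (z : R * R) : \bar R := (k (z.1 + z.2) * (\1_setT z.1 * \1_`[a, b] z.2))%:E.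
have mf : measurable_fun [set: R * R] f by exact: measurable_translate_indic.
have f0 z : (0 <= f z)%E by rewrite lee_fin !mulr_ge0.
have := @measurable_fun_fubini_tonelli_F _ _ _ _ R mu f mf f0.
congr (measurable_fun _ _); apply/funext => x.
by rewrite /fubini_F /f integral_translate_indic patch_setT.
Qed.

Lemma integral_translates_le (k : R -> R) (J : set R) (a d B : R) :
  measurable J -> 0 <= d -> continuous k -> (forall s, 0 <= k s) ->
  (forall s, \int[mu]_(t in J) (k (t + s))%:E <= B%:E)%E ->
  (\int[mu]_(t in J) \int[mu]_(s in `[a, (a + d)%R]) (k (t + s))%:E
   <= (d * B)%:E)%E.
Proof.
move=> mJ d0 ck k0 kB.
pose I := [set` `[a, a + d]].
have mI : measurable I by exact: measurable_itv.
pose f (z : R * R) : \bar R := (k (z.1 + z.2) * (\1_J z.1 * \1_I z.2))%:E.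
have mf : measurable_fun [set: R * R] f by exact: measurable_translate_indic.
have f0 z : (0 <= f z)%E by rewrite lee_fin !mulr_ge0.
have := @fubini_tonelli _ _ _ _ R mu mu f mf f0.
rewrite /fubini_F /fubini_G.
have -> : (\int[mu]_x \int[mu]_y f (x, y) =
    \int[mu]_(t in J) \int[mu]_(s in I) (k (t + s))%:E)%E.
  rewrite [RHS]integral_mkcond; apply: eq_integral => x _.
  exact: integral_translate_indic.
move=> ->.
apply: (@le_trans _ _ (\int[mu]_(s in I) B%:E)%E); last first.
  rewrite integral_cst //=.
  rewrite lebesgue_measure_itv /= lte_fin.
  case: ifPn => _; first by rewrite -EFinB -EFinM addrC addKr mulrC.
  rewrite mule0 lee_fin mulr_ge0 // -lee_fin; apply: le_trans (kB 0).
  by apply: integral_ge0 => t _; rewrite lee_fin.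
rewrite [leRHS]integral_mkcond; apply: ge0_le_integral_nonmeasurable => y _.
  by apply: integral_ge0 => x _; exact: f0.
rewrite patchE; case: ifPn => yI; last first.
  rewrite integral0_eq // => x _; rewrite /f !indicE (negbTE yI) /=.
  by rewrite !mulr0.
apply: le_trans (kB y); rewrite [leRHS]integral_mkcond.
apply: ge0_le_integral_nonmeasurable => x _; first exact: f0.
by rewrite patchE /f !indicE yI mulr1; case: ifPn; rewrite /= ?mulr1 ?mulr0.
Qed.

End local_sup.

Section global_sup.
Context {R : realType}.
Notation mu := (@lebesgue_measure R).

Lemma lee_expe (x y : \bar R) n : (0 <= x)%E -> (x <= y)%E -> (x ^+ n <= y ^+ n)%E.
Proof.
move=> x0 xy; elim: n => [|n IH]; first by rewrite !expe0.
by rewrite !expeS lee_pmul // expe_ge0.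
Qed.

Lemma powR_invnK (x : R) n : (0 < n)%N -> 0 <= x -> (x `^ n%:R^-1) ^+ n = x.
Proof.
move=> n0 x0; rewrite -powR_mulrn ?powR_ge0 // -powRrM mulVf ?powRr1 //.
by rewrite pnatr_eq0 -lt0n.
Qed.

Lemma ereal_sup_expe_le (x : R -> R) (L : set R) (y : \bar R) n :
  (0 < n)%N -> L !=set0 -> (forall t, 0 <= x t) ->
  (forall t, L t -> ((x t ^+ n)%:E <= y)%E) ->
  ((ereal_sup [set (x t)%:E | t in L]) ^+ n <= y)%E.
Proof.
move=> n0 [t0 Lt0] x0 xy.
have y0 : (0 <= y)%E.
  by apply: le_trans (xy _ Lt0); rewrite lee_fin exprn_ge0.
case: y y0 xy => [y| |] // y0 xy; last by rewrite leey.
rewrite lee_fin in y0.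
rewrite -[y in leRHS](powR_invnK n0 y0) EFin_expe lee_expe //.
  apply: le_trans (ereal_sup_ubound _); last (by exists t0; [exact: Lt0|]).
  by rewrite lee_fin.
apply: ge_ereal_sup => _ [t Lt <-]; rewrite lee_fin.
rewrite -(ler_pXn2r n0) ?nnegrE ?powR_ge0 // powR_invnK //.
by rewrite -lee_fin xy.
Qed.

Lemma segment_pieces (x d : R) (m : nat) : 0 <= x -> x <= m.+1%:R * d ->
  exists j : 'I_m.+1, j%:R * d <= x <= j%:R * d + d.
Proof.
elim: m => [|m IH] x0 xm.
  by exists ord0; rewrite mul0r add0r x0 -[d]mul1r.
have [/(IH x0)[j ?]|/ltW mx] := leP x (m.+1%:R * d).
  by exists (widen_ord (leqnSn _) j).
exists ord_max; rewrite mx /= (le_trans xm) // -[m.+2]addn1 natrD mulrDl mul1r.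
by [].
Qed.

Section fixed_sum.
Variables (N q : nat) (phi : 'I_N -> R) (c : 'I_N -> R[i]).
Let h (d s : R) := 2 * q%:R / d * (cmod (exp_sum c phi s) ^+ (2 * q)
    + d ^+ (2 * q) * cmod (exp_sum (deriv_coef c phi) phi s) ^+ (2 * q)).

Definition local_majorant (d b t : R) : \bar R :=
  ((cmod (exp_sum c phi (t + b)) ^+ (2 * q))%:E +
   \int[mu]_(s in `[b, (b + d)%R]) (h d (t + s))%:E)%E.

Let h_ge0 d s : 0 <= d -> 0 <= h d s.
Proof.
move=> d0; rewrite /h mulr_ge0 ?divr_ge0 ?mulr_ge0 //.
by rewrite addr_ge0 ?mulr_ge0 ?exprn_ge0 ?cmod_ge0.
Qed.

Let continuous_h d : continuous (h d).
Proof.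
move=> s; apply: cvgM; first exact: cvg_cst.
apply: cvgD; first exact: continuous_cmod_exp_sum.
by apply: cvgM; [exact: cvg_cst|exact: continuous_cmod_exp_sum].
Qed.

Lemma local_majorantP (d b t u : R) : 0 <= d -> b <= u <= b + d ->
  ((cmod (exp_sum c phi (t + u)) ^+ (2 * q))%:E <= local_majorant d b t)%E.
Proof.
rewrite le_eqVlt => /orP[/eqP <-|d0 ub].
  rewrite addr0 => /le_anti <-; rewrite leeDl // integral_ge0 // => s _.
  by rewrite lee_fin h_ge0.
pose c' n := c n * expi (t * phi n).
have P's s : exp_sum (deriv_coef c phi) phi (t + s) = exp_sum (deriv_coef c' phi) phi s.
  rewrite addrC exp_sumD; apply: eq_bigr => n _; congr (_ * _).
  by rewrite /deriv_coef mulrAC.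
have Ps s : exp_sum c phi (t + s) = exp_sum c' phi s by rewrite addrC exp_sumD.
rewrite /local_majorant Ps [in leRHS]Ps.
under eq_integral do rewrite /h Ps P's.
apply: (@le_integral_of_derivative R (fun s => cmod (exp_sum c' phi s) ^+ (2 * q))
  (deriv_cmod_exp_sum q c' phi)) ub _ _ _ _ _.
- exact: continuous_deriv_cmod_exp_sum.
- move=> s; apply: cvgM; first exact: cvg_cst.
  apply: cvgD; first exact: continuous_cmod_exp_sum.
  by apply: cvgM; [exact: cvg_cst|exact: continuous_cmod_exp_sum].
- exact: is_derive_cmod_exp_sum.
- by move=> s; exact: deriv_cmod_exp_sum_le.
- move=> s; rewrite mulr_ge0 ?divr_ge0 ?mulr_ge0 ?(ltW d0) //.
  by rewrite addr_ge0 ?mulr_ge0 ?exprn_ge0 ?cmod_ge0 ?(ltW d0).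
Qed.

Variables (J : set R) (a T xi : R).
Hypotheses (mJ : measurable J) (JT : J `<=` `[a, a + T]) (T0 : 0 < T).
Hypotheses (xi0 : 0 < xi) (xi_le : (xi%:E <= lin_spacing phi q)%E).
Let B := 32 * (q ^ q)%:R * (T + xi^-1).
Let A1 := \sum_n cmod (c n) ^+ 2.
Let A2 := \sum_n cmod (c n) ^+ 2 * phi n ^+ 2.

Let measurable_P (c' : 'I_N -> R[i]) b :
  measurable_fun [set: R] (fun t => (cmod (exp_sum c' phi (t + b)) ^+ (2 * q))%:E).
Proof.
apply/measurable_EFinP; apply: continuous_measurable_fun.
under eq_fun do rewrite exp_sumD.
exact: continuous_cmod_exp_sum.
Qed.

Lemma measurable_local_majorant d b : 0 <= d ->
  measurable_fun [set: R] (local_majorant d b).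
Proof.
move=> d0; apply: emeasurable_funD; first exact: measurable_P.
by apply: measurable_integral_translates => // s; exact: h_ge0.
Qed.

Lemma local_majorant_ge0 d b t : 0 <= d -> (0 <= local_majorant d b t)%E.
Proof.
move=> d0; apply: adde_ge0; first by rewrite lee_fin exprn_ge0 ?cmod_ge0.
by apply: integral_ge0 => s _; rewrite lee_fin h_ge0.
Qed.

Lemma integral_local_majorant d b : 0 <= d ->
  (\int[mu]_(t in J) local_majorant d b t
   <= ((1 + 2 * q%:R) * B * (A1 ^+ q + d ^+ (2 * q) * A2 ^+ q))%:E)%E.
Proof.
move=> d0.
have B0 : 0 <= B by rewrite /B !mulr_ge0 ?addr_ge0 ?invr_ge0 ?(ltW T0) ?(ltW xi0).
have A10 : 0 <= A1 by apply: sumr_ge0 => n _; exact: sqr_ge0.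
have A20 : 0 <= A2 by apply: sumr_ge0 => n _; rewrite mulr_ge0 ?sqr_ge0.
have d2 : 0 <= d ^+ (2 * q) by rewrite exprn_ge0.
have mom1 s := exp_sum_moment c s mJ xi0 xi_le T0 JT.
have mom2 s := exp_sum_moment (deriv_coef c phi) s mJ xi0 xi_le T0 JT.
have eA2 : \sum_n cmod (deriv_coef c phi n) ^+ 2 = A2.
  by apply: eq_bigr => n _; rewrite cmod_deriv_coef_sqr.
rewrite eA2 -/B -/A1 in mom1 mom2.
rewrite ge0_integralD //; last 4 first.
- by move=> t _; rewrite lee_fin exprn_ge0 ?cmod_ge0.
- by apply: measurable_funTS; exact: measurable_P.
- by move=> t _; apply: integral_ge0 => s _; rewrite lee_fin h_ge0.
- apply: measurable_funTS.
  by apply: measurable_integral_translates => // s; exact: h_ge0.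
have k0 : 0 <= 2 * q%:R / d :> R by rewrite divr_ge0 ?mulr_ge0.
have hB s : (\int[mu]_(t in J) (h d (t + s))%:E <=
    (2 * q%:R / d * (B * A1 ^+ q + d ^+ (2 * q) * (B * A2 ^+ q)))%:E)%E.
  under eq_integral do rewrite /h EFinM EFinD [X in (_ + X)%E]EFinM.
  rewrite ge0_integralZl_EFin //; last 2 first.
  - by move=> t _; rewrite -EFinM -EFinD lee_fin addr_ge0 ?mulr_ge0 ?exprn_ge0 ?cmod_ge0.
  - apply: measurable_funTS; apply: emeasurable_funD; first exact: measurable_P.
    by apply: measurable_funeM; exact: measurable_P.
  rewrite [leRHS]EFinM lee_wpmul2l ?lee_fin //.
  rewrite ge0_integralD //; last 4 first.
  - by move=> t _; rewrite lee_fin exprn_ge0 ?cmod_ge0.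
  - by apply: measurable_funTS; exact: measurable_P.
  - by move=> t _; rewrite -EFinM lee_fin mulr_ge0 ?exprn_ge0 ?cmod_ge0.
  - by apply: measurable_funTS; apply: measurable_funeM; exact: measurable_P.
  rewrite ge0_integralZl_EFin //; last 2 first.
  - by move=> t _; rewrite lee_fin exprn_ge0 ?cmod_ge0.
  - by apply: measurable_funTS; exact: measurable_P.
  by rewrite [leRHS]EFinD leeD // [leRHS]EFinM lee_wpmul2l ?lee_fin.
have hJ := integral_translates_le b mJ d0 (@continuous_h d) (fun s => h_ge0 s d0) hB.
apply: le_trans (leeD (mom1 b) hJ) _; rewrite -EFinD lee_fin.
have X0 : 0 <= B * A1 ^+ q by rewrite mulr_ge0 ?exprn_ge0.
have Y0 : 0 <= d ^+ (2 * q) * (B * A2 ^+ q).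
  by apply: mulr_ge0 => //; apply: mulr_ge0 => //; exact: exprn_ge0.
have -> : (1 + 2 * q%:R) * B * (A1 ^+ q + d ^+ (2 * q) * A2 ^+ q) =
  (1 + 2 * q%:R) * (B * A1 ^+ q + d ^+ (2 * q) * (B * A2 ^+ q)) by ring.
move: X0 Y0; set X := B * _; set Y := _ * (B * _) => X0 Y0.
have q0 : 0 <= 2 * q%:R :> R by rewrite mulr_ge0.
have dd : d * (2 * q%:R / d * (X + Y)) <= 2 * q%:R * (X + Y).
  have [->|dn0] := eqVneq d 0; first by rewrite mul0r mulr_ge0 ?addr_ge0.
  by rewrite le_eqVlt; apply/orP; left; apply/eqP; field.
by apply: le_trans (lerD (lexx _) dd) _; rewrite [leRHS]mulrDl mul1r lerD2r lerDl.
Qed.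

Lemma integral_sup_le (L : set R) (l d al : R) (m : nat) : (0 < q)%N ->
  L !=set0 -> L `<=` `[al, al + l] -> 0 <= d -> l <= m.+1%:R * d ->
  (\int[mu]_(t in J)
      (ereal_sup [set (cmod (exp_sum c phi (t + u)))%:E | u in L]) ^+ (2 * q)
   <= (m.+1%:R * ((1 + 2 * q%:R) * B) *
       (Num.sqrt A1 + d * Num.sqrt A2) ^+ (2 * q))%:E)%E.
Proof.
move=> q0 Lne LT d0 lmd.
pose G (j : 'I_m.+1) := local_majorant d (al + j%:R * d).
apply: (@le_trans _ _ (\int[mu]_(t in J) \sum_(j < m.+1) G j t)%E).
  have [u0 Lu0] := Lne.
  apply: ge0_le_integral_nonmeasurable => t _.
    apply: expe_ge0; apply: le_trans (ereal_sup_ubound _); last first.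
      by exists u0; [exact: Lu0|].
    by rewrite lee_fin cmod_ge0.
  apply: (@ereal_sup_expe_le (fun u => cmod (exp_sum c phi (t + u)))) => //.
  - by rewrite muln_gt0.
  - by move=> u; exact: cmod_ge0.
  move=> u /LT /=; rewrite in_itv /= => /andP[alu ual].
  have [j /andP[j1 j2]] : exists j : 'I_m.+1, j%:R * d <= u - al <= j%:R * d + d.
    by apply: segment_pieces; lra.
  apply: (@le_trans _ _ (G j t)).
    by apply: local_majorantP => //; apply/andP; split; lra.
  rewrite (bigD1 j) //= leeDl // sume_ge0 // => i _.
  exact: local_majorant_ge0.
rewrite ge0_integral_sum //; last 2 first.
- by move=> j; apply: measurable_funTS; exact: measurable_local_majorant.
- by move=> j t _; exact: local_majorant_ge0.
apply: (@le_trans _ _ (\sum_(j < m.+1)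
    ((1 + 2 * q%:R) * B * (A1 ^+ q + d ^+ (2 * q) * A2 ^+ q))%:E)%E).
  by apply: lee_sum => j _; exact: integral_local_majorant.
have B0 : 0 <= B by rewrite /B !mulr_ge0 ?addr_ge0 ?invr_ge0 ?(ltW T0) ?(ltW xi0).
move: (B) B0 => b b0.
rewrite sumEFin sumr_const card_ord lee_fin -[leLHS]mulr_natl -[leRHS]mulrA.
rewrite ler_wpM2l // ler_wpM2l ?mulr_ge0 ?addr_ge0 //.
have A10 : 0 <= A1 by apply: sumr_ge0 => n _; exact: sqr_ge0.
have A20 : 0 <= A2 by apply: sumr_ge0 => n _; rewrite mulr_ge0 ?sqr_ge0.
have -> : A1 ^+ q = Num.sqrt A1 ^+ (2 * q) by rewrite exprM sqr_sqrtr.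
have -> : A2 ^+ q = Num.sqrt A2 ^+ (2 * q) by rewrite exprM sqr_sqrtr.
rewrite -exprMn; have : 0 <= d * Num.sqrt A2 by rewrite mulr_ge0 ?sqrtr_ge0.
have : 0 <= Num.sqrt A1 by exact: sqrtr_ge0.
have : (0 < 2 * q)%N by rewrite muln_gt0.
move: (Num.sqrt A1) (d * _) (2 * q)%N => x y [//|n] _ x0 y0.
rewrite !exprSr [leRHS]mulrDr lerD // ler_wpM2r // lerXn2r ?nnegrE ?addr_ge0 //.
  by rewrite lerDl.
by rewrite lerDr.
Qed.

End fixed_sum.
End global_sup.

Section intervals.
Context {R : realType}.
Notation mu := (@lebesgue_measure R).

Lemma interval_subset_segment (I : set R) (l : R) :
  is_interval I -> I !=set0 -> itv_length I = l%:E ->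
  exists a, I `<=` `[a, a + l].
Proof.
move=> itvI I0 lI.
have mI := is_interval_measurable itvI.
have dist x y : I x -> I y -> y - x <= l.
  move=> Ix Iy; have l0 : 0 <= l by rewrite -lee_fin -lI; exact: measure_ge0.
  have [yx|xy] := leP y x; first by lra.
  rewrite -lee_fin -lI /itv_length.
  have <- : mu `[x, y] = (y - x)%:E by rewrite lebesgue_measure_itv /= lte_fin xy.
  apply: le_measure; rewrite ?inE //.
  by move=> z /=; rewrite in_itv /= => /(itvI x y Ix Iy).
have [x0 Ix0] := I0.
have lbI : has_lbound I by exists (x0 - l) => y Iy; have := dist y x0 Iy Ix0; lra.
exists (inf I) => x Ix /=; rewrite in_itv /= ge_inf //=.
suff : x - l <= inf I by lra.
by apply: lb_le_inf => // y Iy; have := dist y x Iy Ix; lra.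
Qed.

Lemma bounded_set_length_lty (I : set R) :
  is_interval I -> bounded_set I -> (itv_length I < +oo)%E.
Proof.
move=> itvI /pinfty_ex_gt0[M M0 IM].
apply: (@le_lt_trans _ _ (mu `[- M, M])).
  apply: le_measure; rewrite ?inE //; first exact: is_interval_measurable.
  by move=> x Ix /=; rewrite in_itv /= -ler_norml IM.
by rewrite lebesgue_measure_itv /=; case: ifP => _; rewrite ltry.
Qed.

Lemma lin_spacing_ge0 (N q : nat) (phi : 'I_N -> R) : (0 <= lin_spacing phi q)%E.
Proof.
by apply/ereal_infP => _ [h [k [_ _ _ ->]]]; rewrite lee_fin.
Qed.

Lemma max_abs_gt0 (N : nat) (phi : 'I_N -> R) :
  (0 < N)%N -> rat_lin_indep phi -> 0 < max_abs phi.
Proof.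
case: N phi => // N phi _ indep.
have phi0 : phi ord0 != 0.
  apply/negP => /eqP p0.
  have := indep (fun n => if n == ord0 then 1 else 0).
  rewrite big1 => [/(_ erefl ord0)/=/eqP|n _]; first by rewrite oner_eq0.
  by case: eqP => [->|_]; rewrite ?p0 ?mulr0 // rmorph0 mul0r.
rewrite /max_abs (bigD1 ord0) //= lt_max normr_gt0 phi0 //.
Qed.

End intervals.

Theorem theorem2p3 (R : realType) (q : nat) (q_gt0 : (0 < q)%N) :
  exists C : R,
    forall (N : nat) (phi : 'I_N -> R) (c : 'I_N -> R[i]) (J L : set R),
      (1 <= N)%N ->
      rat_lin_indep phi ->
      is_interval J -> bounded_set J -> (0 < itv_length J)%E ->
      is_interval L -> L !=set0 ->
      (((itv_length J)^-1 *
          \int[lebesgue_measure]_(theta in J)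
            (ereal_sup [set (cmod (exp_sum c phi (theta + t)))%:E | t in L])
              ^+ (2 * q))
         `^ (2 * q)%:R^-1
       <= C%:E * spacing_factor phi q J
          * Order.max 1 (itv_length L * (max_abs phi)%:E) `^ (2 * q)%:R^-1
          * ((Num.sqrt (\sum_(n < N) cmod (c n) ^+ 2))%:E
             + Order.min (itv_length L) (max_abs phi)%:E^-1
               * (Num.sqrt (\sum_(n < N) cmod (c n) ^+ 2 * phi n ^+ 2))%:E))%E.
Proof.
pose K : R := 4 * ((1 + 2 * q%:R) * (32 * (q ^ q)%:R)).
have K1 : 1 <= K.
  have q1 : 1 <= q%:R :> R by rewrite ler1n.
  have qq1 : 1 <= (q ^ q)%:R :> R by rewrite ler1n expn_gt0 q_gt0.
  by rewrite /K; nra.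
exists K => N phi c J L N0 indep itvJ bJ J0 itvL Lne.
have nq : (0 < 2 * q)%N by rewrite muln_gt0.
set r : R := (2 * q)%:R^-1.
have r0 : 0 < r by rewrite invr_gt0 ltr0n.
have r1 : r <= 1 by rewrite invf_le1 ?ltr0n // ler1n.
have ph0 := max_abs_gt0 N0 indep; set ph := max_abs phi in ph0 *.
have mJ := is_interval_measurable itvJ.
have [T T0 JE] : exists2 T : R, 0 < T & itv_length J = T%:E.
  have := bounded_set_length_lty itvJ bJ; move: J0.
  by case: (itv_length J) => [T T0 _| |] //; exists T.
have [a JT] : exists a, J `<=` `[a, a + T].
  apply: interval_subset_segment => //.
  by apply/set0P/eqP => J_0; move: J0; rewrite J_0 /itv_length measure0 ltxx.
rewrite JE inver gt_eqF //.
set A1 := \sum_(n < N) cmod (c n) ^+ 2.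
set A2 := \sum_(n < N) cmod (c n) ^+ 2 * phi n ^+ 2.
set S1 := Num.sqrt A1; set S2 := Num.sqrt A2.
set F := (X in (((_%:E * X) `^ _) <= _)%E).
have S10 : 0 <= S1 by exact: sqrtr_ge0.
have S20 : 0 <= S2 by exact: sqrtr_ge0.
have L0 : (0 <= itv_length L)%E by exact: measure_ge0.
have xi0 := lin_spacing_ge0 q phi.
have phV : ph%:E^-1%E = ph^-1%:E :> \bar R by rewrite inver gt_eqF.
rewrite phV.
have min0 : (0 <= Order.min (itv_length L) ph^-1%:E)%E.
  by rewrite le_min L0 lee_fin invr_ge0 ltW.
have Z0 : (0 <= S1%:E + Order.min (itv_length L) ph^-1%:E * S2%:E)%E.
  by rewrite adde_ge0 ?mule_ge0 ?lee_fin.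
have sf1 : (1 <= q`!%:R%:E * (1 + (2 * pi)%:E / (T%:E * lin_spacing phi q)))%E.
  rewrite -[leLHS]mul1e lee_pmul //; first by rewrite lee_fin ler1n fact_gt0.
  by rewrite leeDl // mule_ge0 ?inve_ge0 ?mule_ge0 ?lee_fin ?mulr_ge0 ?pi_ge0 ?(ltW T0).
rewrite /spacing_factor JE.
set sf := (X in (_ * X `^ _ * _ * _)%E) in sf1 *.
have powR_ge1 x : (1 <= x)%E -> (1 <= x `^ r)%E.
  move=> x1; rewrite -(poweR1r r).
  apply: gt0_ler_poweR; rewrite ?(ltW r0) // in_itv /= leey andbT ?lee01 //.
  exact: le_trans x1.
have sup_ge0 t : (0 <= ereal_sup
    [set (cmod (exp_sum c phi (t + u)))%:E | u in L] ^+ (2 * q))%E.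
  apply: expe_ge0; have [u Lu] := Lne.
  apply: le_trans (ereal_sup_ubound _); last (by exists u; [exact: Lu|]).
  by rewrite lee_fin cmod_ge0.
have F0 : (0 <= F)%E by apply: integral_ge0 => t _; exact: sup_ge0.
have [A10|A1n0] := eqVneq A1 0.
  have c0 n : c n = 0.
    move/eqP: A10; rewrite psumr_eq0 => [/allP/(_ n)|i _]; last exact: sqr_ge0.
    rewrite mem_index_enum => /(_ isT) /=.
    by rewrite sqrf_eq0 -(inj_eq (@complexI R)) cmodE normr_eq0 => /eqP.
  have -> : F = 0%E.
    apply/eqP; rewrite eq_le F0 andbT.
    rewrite -[leRHS](@integral0 _ _ _ (@lebesgue_measure R) J).
    apply: ge0_le_integral_nonmeasurable => t _; first exact: sup_ge0.
    apply: (@ereal_sup_expe_le _ (fun u => cmod (exp_sum c phi (t + u)))) => //.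
      by move=> u; exact: cmod_ge0.
    move=> u _; rewrite /exp_sum big1 => [|n _]; last by rewrite c0 mul0r.
    by rewrite /cmod normr0 /= expr0n (gtn_eqF nq).
  rewrite mule0 poweR0r ?gt_eqF //.
  by rewrite !mule_ge0 ?poweR_ge0 // lee_fin (le_trans _ K1).
have S1_gt0 : 0 < S1.
  by rewrite sqrtr_gt0 lt_neqAle eq_sym A1n0 sumr_ge0 // => n _; exact: sqr_ge0.
have Z_gt0 : (0 < S1%:E + Order.min (itv_length L) ph^-1%:E * S2%:E)%E.
  by rewrite (@lt_le_trans _ _ S1%:E) ?lte_fin // leeDl // mule_ge0 ?lee_fin.
have K_gt0 : (0 < K%:E)%E by rewrite lte_fin (lt_le_trans _ K1).
have sfr := powR_ge1 _ sf1.
have sfr_gt0 : (0 < sf `^ r)%E := lt_le_trans lte01 sfr.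
have M1 : (1 <= Order.max 1 (itv_length L * ph%:E))%E by rewrite le_max lexx.
have Mr_gt0 := lt_le_trans lte01 (powR_ge1 _ M1).
have [LE|Lfin] := eqVneq (itv_length L) +oo%E.
  rewrite LE gt0_mulye ?lte_fin // maxey poweRyr ?gt_eqF //.
  rewrite [(_ * +oo)%E]gt0_muley ?mule_gt0 //.
  by rewrite gt0_mulye ?leey // -?LE.
have [sfE|[b [x [x0 xle sfE b1]]]] : sf = +oo%E \/
    exists b x, [/\ 0 < x, (x%:E <= lin_spacing phi q)%E, sf = b%:E &
      1 + (T * x)^-1 <= 2 * b].
  have qf : 1 <= q`!%:R :> R by rewrite ler1n fact_gt0.
  have pi2 := pi_ge2 R.
  rewrite /sf; case: (lin_spacing phi q) xi0 => [x| |] //.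
    rewrite lee_fin le_eqVlt => /orP[/eqP <-|x0]; [left|right].
      rewrite mule0 inve0 gt0_muley ?lte_fin ?mulr_gt0 ?pi_gt0 //.
      by rewrite addey // gt0_muley // lte_fin (lt_le_trans _ qf).
    exists (q`!%:R * (1 + 2 * pi / (T * x))), x; split => //.
      rewrite -EFinM inver gt_eqF ?mulr_gt0 //.
    have y0 : 0 < (T * x)^-1 by rewrite invr_gt0 mulr_gt0.
    have wy : (T * x)^-1 <= 2 * pi / (T * x) by rewrite ler_peMl ?(ltW y0) //; lra.
    have : 1 + 2 * pi / (T * x) <= q`!%:R * (1 + 2 * pi / (T * x)).
      by rewrite ler_peMl //; lra.
    lra.
  move=> _; right; exists q`!%:R, T^-1; split.
  - by rewrite invr_gt0.
  - by rewrite leey.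
  - by rewrite gt0_muley ?lte_fin // invey mule0 adde0 mule1.
  - by rewrite mulfV ?gt_eqF // invr1; lra.
  rewrite sfE poweRyr ?gt_eqF // gt0_muley //.
  by rewrite !gt0_mulye // leey.
have [l l0 lE] : exists2 l, 0 <= l & itv_length L = l%:E.
  by case: (itv_length L) L0 Lfin => [l| |] //; rewrite lee_fin => l0 _; exists l.
have [al LT] := interval_subset_segment itvL Lne lE.
rewrite lE -EFin_min -EFinM -EFin_max -EFinM -EFinD.
set d := Num.min l ph^-1; set M := Num.max 1 (l * ph).
have d0 : 0 <= d by rewrite le_min l0 invr_ge0 ltW.
have M_ge1 : 1 <= M by rewrite le_max lexx.
pose m := Num.truncn M.
have mM : m%:R <= M by rewrite truncn_le (le_trans _ M_ge1).
have Mm : M < m.+1%:R by exact: truncnS_gt.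
have ld : l <= m.+1%:R * d.
  rewrite /d; case: (leP l ph^-1) => lp.
    by rewrite ler_peMl // ler1n.
  rewrite ler_pdivlMr //; apply: le_trans (ltW Mm).
  by rewrite le_max lexx orbT.
have := integral_sup_le c mJ JT T0 x0 xle q_gt0 Lne LT d0 ld.
rewrite -/F -/A1 -/A2 -/S1 -/S2.
set Z := S1 + d * S2; set V := _ * _ ^+ (2 * q) => FV.
have Z_ge0 : 0 <= Z by rewrite addr_ge0 ?mulr_ge0.
have b0 : 0 <= b by rewrite -lee_fin -sfE (le_trans _ sf1) ?lee01.
have TV : T^-1 * V <= K * b * M * Z ^+ (2 * q).
  have -> : T^-1 * V = 32 * (1 + 2 * q%:R) * (q ^ q)%:R *
      (m.+1%:R * (1 + (T * x)^-1)) * Z ^+ (2 * q).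
    by rewrite /V; field; rewrite !gt_eqF.
  rewrite ler_wpM2r ?exprn_ge0 //.
  have -> : K * b * M = 32 * (1 + 2 * q%:R) * (q ^ q)%:R * ((2 * M) * (2 * b)).
    by rewrite /K; ring.
  rewrite ler_wpM2l ?mulr_ge0 ?addr_ge0 ?mulr_ge0 //.
  rewrite ler_pM ?addr_ge0 ?invr_ge0 ?mulr_ge0 ?(ltW T0) ?(ltW x0) //.
  by rewrite -natr1; lra.
apply: (@le_trans _ _ ((K * b * M * Z ^+ (2 * q))%:E `^ r)%E).
  apply: gt0_ler_poweR; rewrite ?(ltW r0) //.
  - by rewrite in_itv /= leey mule_ge0 // lee_fin invr_ge0 ltW.
  - rewrite in_itv /= leey lee_fin.
    by rewrite !mulr_ge0 ?exprn_ge0 ?(le_trans ler01 K1) ?(le_trans ler01 M_ge1).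
  apply: le_trans (lee_wpmul2l _ FV) _; first by rewrite lee_fin invr_ge0 ltW.
  by rewrite -EFinM lee_fin.
clearbody K; rewrite sfE !poweR_EFin -!EFinM lee_fin.
have K0 : 0 <= K by rewrite (le_trans _ K1).
have Mge0 : 0 <= M by rewrite (le_trans _ M_ge1).
rewrite !powRM ?mulr_ge0 ?exprn_ge0 //.
rewrite -powR_mulrn // -powRrM mulfV ?powRr1 ?pnatr_eq0 -?lt0n //.
rewrite !ler_wpM2r ?powR_ge0 //.
by rewrite -[leRHS]powRr1 // ler_powR.
Qed.
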